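(* Let $\mathbf{A}\in\mathbb{C}^{m\times n}$ and $\mathbf{y}\in\mathbb{C}^{m}$ (a column vector), consider the system of linear equations $\mathbf{A}\mathbf{x}=\mathbf{y}$, and put $\mathbf{f}=\mathbf{A}^{*}\mathbf{y}$. Let $\mathbf{x}^{0}=(x^{0}_{1},\dots,x^{0}_{n})^{T}$ be the least squares solution of this system. (i) If $\operatorname{rank}\mathbf{A}=n$, then $$x^{0}_{j}=\frac{\det(\mathbf{A}^{*}\mathbf{A})_{.\,j}(\mathbf{f})}{\det \mathbf{A}^{*}\mathbf{A}}\qquad\text{for all } j=1,\dots,n.$$ (ii) If $\operatorname{rank}\mathbf{A}=r\le m<n$ with $r\ge 1$, then $$x^{0}_{j}=\frac{\displaystyle\sum_{\beta\in J_{r,n}\{j\}}\left|\left((\mathbf{A}^{*}\mathbf{A})_{.\,j}(\mathbf{f})\right)^{\beta}_{\beta}\right|}{d_{r}(\mathbf{A}^{*}\mathbf{A})}\qquad\text{for all } j=1,\dots,n.$$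
   Context: $\|\cdot\|$ is the Euclidean norm and $\mathbf{A}^{*}$ the conjugate transpose of $\mathbf{A}$. The least squares solution of $\mathbf{A}\mathbf{x}=\mathbf{y}$ is the vector $\mathbf{x}^{0}\in\mathbb{C}^{n}$ of minimal Euclidean norm among all minimizers of $\|\mathbf{A}\mathbf{x}-\mathbf{y}\|$ over $\mathbf{x}\in\mathbb{C}^{n}$, i.e. a minimizer satisfying $\|\mathbf{x}^{0}\|=\min\{\|\tilde{\mathbf{x}}\| : \tilde{\mathbf{x}}\in\mathbb{C}^n,\ \|\mathbf{A}\tilde{\mathbf{x}}-\mathbf{y}\|=\min_{\mathbf{x}\in\mathbb{C}^{n}}\|\mathbf{A}\mathbf{x}-\mathbf{y}\|\}$; it equals $\mathbf{A}^{+}\mathbf{y}$, where $\mathbf{A}^{+}$ is the Moore–Penrose inverse. $\mathbf{B}_{.\,j}(\mathbf{b})$ is the matrix obtained from $\mathbf{B}$ by replacing its $j$th column by the column vector $\mathbf{b}$. For $1\le r\le n$, $J_{r,n}$ is the set of all strictly increasing sequences of $r$ integers chosen from $\{1,\dots,n\}$, and $J_{r,n}\{j\}$ is the set of those $\beta\in J_{r,n}$ containing $j$. $|\mathbf{B}^{\beta}_{\beta}|$ is the principal minor of the square matrix $\mathbf{B}$ with rows and columns indexed by $\beta$. $d_{r}(\mathbf{A}^{*}\mathbf{A})=\sum_{\beta\in J_{r,n}}|(\mathbf{A}^{*}\mathbf{A})^{\beta}_{\beta}|$. *)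

(* Defs.v *)
From HB Require Import structures.
From mathcomp Require Export all_boot all_order all_algebra.
From mathcomp Require Export reals complex.

Set Implicit Arguments.
Unset Strict Implicit.
Unset Printing Implicit Defensive.

Import Order.TTheory GRing.Theory Num.Theory.
Local Open Scope ring_scope.

Section Norm.
Variable C : numClosedFieldType.

(* The value is a nonnegative real element of C; on such elements the partial
   order of C is the usual order of the reals. *)
Definition l2norm n (v : 'cV[C]_n) : C := sqrtC (\sum_(i < n) `|v i 0| ^+ 2).

Definition is_minimizer m n (A : 'M[C]_(m, n)) (y : 'cV[C]_m) (x : 'cV[C]_n) :=
  forall z : 'cV[C]_n, l2norm (A *m x - y) <= l2norm (A *m z - y).

Definition is_least_squares_solution m n
    (A : 'M[C]_(m, n)) (y : 'cV[C]_m) (x : 'cV[C]_n) :=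
  is_minimizer A y x /\
  forall z : 'cV[C]_n, is_minimizer A y z -> l2norm x <= l2norm z.

End Norm.

Section Minors.
Variable R : comNzRingType.

Definition replace_col m n (B : 'M[R]_(m, n)) (j : 'I_n) (b : 'cV[R]_m)
    : 'M[R]_(m, n) :=
  \matrix_(i, k) if k == j then b i 0 else B i k.

Definition J_ (r n : nat) : {set r.-tuple 'I_n} :=
  [set beta : r.-tuple 'I_n | sorted ltn (map val beta)].

Definition J_at (r n : nat) (j : 'I_n) : {set r.-tuple 'I_n} :=
  [set beta in J_ r n | j \in beta].

Definition principal_minor n (B : 'M[R]_n) r (beta : r.-tuple 'I_n) : R :=
  \det (mxsub (tnth beta) (tnth beta) B).

Definition sum_principal_minors (r : nat) n (B : 'M[R]_n) : R :=
  \sum_(beta in J_ r n) principal_minor B beta.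

End Minors.

(* Main.v *)
Require Import Defs.
From mathcomp Require Import fingroup perm.
Import Order.TTheory GRing.Theory Num.Theory.
Local Open Scope ring_scope.
Local Open Scope complex_scope.
Local Open Scope sesquilinear_scope.

Set Implicit Arguments.
Unset Strict Implicit.

(** Everything is read off a full rank factorization A = P Q, with P of full
    column rank r, Q of full row rank r. Put L = Q^*, M = P^* P Q, so that
    A^* A = L M, and let G = M L = (P^* P)(Q Q^* ), a product of two invertible
    Gram matrices.

    Least squares. The vector x1 = L u with u = G^-1 P^* y solves the normal
    equations A^* A x = A^* y and lies in the range of A^*. By Pythagoras the
    first property makes A x1 the best approximation of y in the range of A,
    and the second makes x1 the shortest vector with that image, so the least
    squares solution is x1 ([least_squares_solution_unique]).

    Determinants. Replacing column j of A^* A = L M by A^* y = L (G u) gives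
    L N, where N is M with column j replaced by G u. A principal minor of order
    r of L N is the product of a maximal minor of L and one of N, so sums of
    such minors are evaluated by the Cauchy-Binet formula: the denominator
    d_r(A^* A) is det G. In the numerator, the minors that avoid column j do
    not depend on the vector put there, and those that use it vanish when that
    vector is 0; hence the numerator is det (N L) - det (N' L), where N' is M
    with column j replaced by 0. Both N L and N' L are rank one perturbations
    of G, and the determinant formula for these turns the difference into
    (row j of L) u times det G, which is x1_j det G
    ([sum_minors_replace_col]).

    When A has rank n, A^* A is invertible and the normal equations are solved
    by the ordinary Cramer rule. *)

(** * The Cauchy-Binet formula *)

Section CauchyBinet.
Variable R : comNzRingType.

Lemma det_mulmx_sum_ffun r n (M : 'M[R]_(r, n)) (L : 'M[R]_(n, r)) :
  \det (M *m L) =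
    \sum_(f : {ffun 'I_r -> 'I_n}) (\prod_i M i (f i)) * \det (rowsub f L).
Proof.
under [RHS]eq_bigr => f _ do rewrite big_distrr /=.
rewrite exchange_big /=; apply: eq_bigr => s _.
under eq_bigr => i _ do rewrite mxE.
rewrite bigA_distr_bigA big_distrr /=; apply: eq_bigr => f _.
rewrite mulrCA big_split /=; congr (_ * (_ * _)).
by apply: eq_bigr => i _; rewrite mxE.
Qed.

Lemma tnth_J_inj r n (beta : r.-tuple 'I_n) :
  beta \in J_ r n -> injective (tnth beta).
Proof.
rewrite inE => /(sorted_uniq ltn_trans ltnn) /map_uniq.
by move/tuple_uniqP.
Qed.

Definition ffun_tuple_perm r n (bs : r.-tuple 'I_n * 'S_r)
    : {ffun 'I_r -> 'I_n} :=
  [ffun i => tnth bs.1 (bs.2 i)].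

(** An injection is determined by its sorted image and the permutation of
    positions that sorts it. This is what groups the terms of a sum over
    injections by their image. *)
Lemma ffun_tuple_perm_inj r n :
  {in setX (J_ r n) [set: 'S_r] &, injective (@ffun_tuple_perm r n)}.
Proof.
move=> [b s] [c t]; rewrite !in_setX !inE !andbT /= => Jb Jc /ffunP eq_bc.
have eq_i i : tnth b (s i) = tnth c (t i) by have := eq_bc i; rewrite !ffunE.
have eqbc : b = c.
  apply/val_inj/(inj_map val_inj)/(irr_sorted_eq ltn_trans ltnn) => // k.
  apply/mapP/mapP => -[_ /tnthP[i ->] ->].
    exists (tnth c (t (s^-1 i)%g)); rewrite ?mem_tnth//.
    by rewrite -eq_i permKV.
  exists (tnth b (s (t^-1 i)%g)); rewrite ?mem_tnth//.
  by rewrite eq_i permKV.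
rewrite -eqbc in eq_i *; congr pair.
by apply/permP => i; apply: (@tnth_J_inj _ _ b _); rewrite ?inE.
Qed.

Lemma ffun_tuple_perm_onto r n (f : {ffun 'I_r -> 'I_n}) :
  injective f ->
  exists2 b, b \in J_ r n & exists s : 'S_r, f = ffun_tuple_perm (b, s).
Proof.
move=> f_inj; pose c := [tuple f i | i < r].
pose b := sort_tuple (fun i j : 'I_n => (i <= j)%N) c.
have Jb : b \in J_ r n.
  rewrite inE ltn_sorted_uniq_leq map_inj_uniq; last exact: val_inj.
  rewrite sort_uniq (map_inj_uniq f_inj) enum_uniq /= sorted_map.
  by apply: sort_sorted => i j; apply: leq_total.
exists b => //.
have /tuple_permP[s def_c] : perm_eq c b by rewrite perm_sym perm_sort.
exists s; apply/ffunP => i; rewrite ffunE.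
have def_c' : c = [tuple tnth b (s i) | i < r] by apply: val_inj.
by rewrite -[LHS](tnth_mktuple f) -/c def_c' tnth_mktuple.
Qed.

(** In [det_mulmx_sum_ffun] a function that is not injective repeats a row of L
    and contributes 0. The injections with a given sorted image beta run over
    beta \o s for s a permutation; extracting the sign of s from the minor of L
    leaves the Leibniz expansion of the minor of M. *)
Lemma Cauchy_Binet r n (M : 'M[R]_(r, n)) (L : 'M[R]_(n, r)) :
  \det (M *m L) = \sum_(beta in J_ r n)
    \det (colsub (tnth beta) M) * \det (rowsub (tnth beta) L).
Proof.
rewrite det_mulmx_sum_ffun.
rewrite (bigID (fun f : {ffun 'I_r -> 'I_n} => injectiveb f)) /=.
rewrite [X in _ + X]big1 ?addr0 => [|f /injectivePn[i [j neq_ij eq_f]]].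
  have injE (f : {ffun 'I_r -> 'I_n}) :
      injectiveb f = (f \in @ffun_tuple_perm r n @: setX (J_ r n) [set: 'S_r]).
    apply/injectiveP/imsetP => [/ffun_tuple_perm_onto[b Jb [s ->]]|[[b s]]].
      by exists (b, s); rewrite // in_setX Jb inE.
    rewrite in_setX /= => /andP[Jb _] -> i j; rewrite !ffunE /=.
    by move/(tnth_J_inj Jb)/perm_inj.
  rewrite (eq_bigl _ _ injE) big_imset /=; last exact: ffun_tuple_perm_inj.
  rewrite (eq_bigl (fun bs => (bs.1 \in J_ r n) && true)); last first.
    by case=> b s; rewrite [LHS]in_setX !inE.
  rewrite -(pair_big (mem (J_ r n)) xpredT (fun b s =>
    (\prod_i M i (ffun_tuple_perm (b, s) i)) *
    \det (rowsub (ffun_tuple_perm (b, s)) L))) /=.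
  apply: eq_bigr => b _; rewrite big_distrl /=; apply: eq_bigr => s _.
  have -> : rowsub (ffun_tuple_perm (b, s)) L = row_perm s (rowsub (tnth b) L).
    by apply/matrixP => i k; rewrite !mxE ffunE.
  rewrite row_permE det_mulmx det_perm mulrCA mulrA; congr (_ * _ * _).
  by apply: eq_bigr => i _; rewrite mxE ffunE.
rewrite (determinant_alternate neq_ij) ?mulr0 // => k.
by rewrite !mxE eq_f.
Qed.

Lemma principal_minor_mulmx r n (L : 'M[R]_(n, r)) (N : 'M[R]_(r, n))
    (beta : r.-tuple 'I_n) :
  principal_minor (L *m N) beta =
    \det (colsub (tnth beta) N) * \det (rowsub (tnth beta) L).
Proof. by rewrite /principal_minor mxsub_mul det_mulmx mulrC. Qed.

Lemma sum_principal_minors_mulmx r n (L : 'M[R]_(n, r)) (N : 'M[R]_(r, n)) :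
  sum_principal_minors r (L *m N) = \det (N *m L).
Proof.
rewrite Cauchy_Binet; apply: eq_bigr => beta _.
exact: principal_minor_mulmx.
Qed.

End CauchyBinet.

(** * Column replacement *)

Section ReplaceCol.
Variable R : comUnitRingType.

Lemma replace_colE m n (M : 'M[R]_(m, n)) j b :
  replace_col M j b = M + (b - col j M) *m delta_mx 0 j.
Proof.
apply/matrixP => i k; rewrite !mxE big_ord1 !mxE /=.
by have [->|_] := eqVneq k j; rewrite ?mulr1 ?mulr0 ?addr0 // addrC subrK.
Qed.

Lemma mulmx_replace_col m n p (L : 'M[R]_(m, n)) (M : 'M[R]_(n, p)) j b :
  replace_col (L *m M) j (L *m b) = L *m replace_col M j b.
Proof.
rewrite !replace_colE !colE -[_ *m M *m _]mulmxA -mulmxBr.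
by rewrite [RHS]mulmxDr mulmxA.
Qed.

(** Both factorizations of the block matrix with rows (1, -l) and (c, 1), by
    eliminating either diagonal block, compute its determinant. *)
Lemma det_add1_rank1 n (c : 'cV[R]_n) (l : 'rV[R]_n) :
  \det (1%:M + c *m l) = 1 + (l *m c) 0 0.
Proof.
have eqX : block_mx 1%:M 0 c 1%:M *m block_mx 1%:M (- l) 0 (1%:M + c *m l) =
    block_mx (1%:M + l *m c) (- l) 0 1%:M *m block_mx 1%:M 0 c 1%:M 
      :> 'M_(1 + n).
  rewrite !mulmx_block !(mul0mx, mulmx0, mul1mx, mulmx1, addr0, add0r).
  by rewrite mulmxN mulNmx addrK addrCA addNr addr0.
move/(congr1 determinant): eqX.
rewrite !det_mulmx !det_lblock !det_ublock !det1 !(mul1r, mulr1) => ->.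
by rewrite det_mx11 mxE mxE.
Qed.

Lemma det_add_rank1 n (G : 'M[R]_n) (c : 'cV[R]_n) (l : 'rV[R]_n) :
  G \in unitmx ->
  \det (G + c *m l) = \det G * (1 + (l *m invmx G *m c) 0 0).
Proof.
move=> uG; have -> : G + c *m l = G *m (1%:M + invmx G *m c *m l).
  by rewrite mulmxDr mulmx1 !mulmxA mulmxV // mul1mx.
by rewrite det_mulmx det_add1_rank1 mulmxA.
Qed.

(** Replacing column j of B by B x multiplies B by the identity matrix with
    column j replaced by x, whose determinant is x_j. *)
Lemma Cramer_rule n (B : 'M[R]_n) (x : 'cV[R]_n) j :
  \det (replace_col B j (B *m x)) = \det B * x j 0.
Proof.
rewrite -{1}[B]mulmx1 mulmx_replace_col det_mulmx replace_colE det_add1_rank1.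
by rewrite -rowE !mxE eqxx [1 + _]addrC subrK.
Qed.

Lemma colsub_replace_col_notin r m n (M : 'M[R]_(m, n)) j b
    (beta : r.-tuple 'I_n) :
  j \notin beta ->
  colsub (tnth beta) (replace_col M j b) = colsub (tnth beta) M.
Proof.
move=> j_beta; apply/matrixP => i k; rewrite !mxE.
by case: eqP => // def_j; rewrite -def_j mem_tnth in j_beta.
Qed.

Lemma det_colsub_replace_col0 r n (M : 'M[R]_(r, n)) j (beta : r.-tuple 'I_n) :
  j \in beta -> \det (colsub (tnth beta) (replace_col M j 0)) = 0.
Proof.
case/tnthP => k def_j; rewrite (expand_det_col _ k) big1 // => i _.
by rewrite !mxE -def_j eqxx mul0r.
Qed.

(** The determinant on the left is affine in w: the beta avoiding j contribute
    its constant term, its value at 0, and those containing j its linear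
    part. *)
Lemma det_replace_col_mulmx r n (L : 'M[R]_(n, r)) (M : 'M[R]_(r, n)) j w :
  \det (replace_col M j w *m L) = \det (replace_col M j 0 *m L) +
    \sum_(beta in J_at r j) principal_minor (L *m replace_col M j w) beta.
Proof.
rewrite !Cauchy_Binet (big_setID (J_at r j)) /=.
rewrite [X in _ = X + _](big_setID (J_at r j)) /=.
have -> : J_ r n :&: J_at r j = J_at r j.
  by apply/setP => beta; rewrite !inE andbA andbb.
rewrite [X in _ = X + _ + _]big1 => [|beta]; last first.
  by rewrite inE => /andP[_ /det_colsub_replace_col0 ->]; rewrite mul0r.
rewrite add0r addrC; congr (_ + _); last first.
  by apply: eq_bigr => beta _; rewrite principal_minor_mulmx.
apply: eq_bigr => beta; rewrite in_setD inE => /andP[notJj Jbeta].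
by rewrite Jbeta in notJj; rewrite !colsub_replace_col_notin.
Qed.

(** By the rank one formula, the linear part of w |-> det (G + (w - c) l),
    where G = M L, l = row j L and c = col j M, is det G * l G^-1 w, which is
    det G * l u at w = G u. *)
Lemma sum_minors_replace_col r n (L : 'M[R]_(n, r)) (M : 'M[R]_(r, n))
    (u : 'cV[R]_r) j :
  M *m L \in unitmx ->
  \sum_(beta in J_at r j)
      principal_minor (replace_col (L *m M) j (L *m (M *m L *m u))) beta =
    (L *m u) j 0 * \det (M *m L).
Proof.
move=> uG; rewrite mulmx_replace_col; set w := M *m L *m u.
have detE b : \det (replace_col M j b *m L) = \det (M *m L) *
    (1 + (row j L *m invmx (M *m L) *m (b - col j M)) 0 0).
  by rewrite replace_colE mulmxDl -mulmxA -rowE det_add_rank1.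
have /(canLR (addKr _)) <- := det_replace_col_mulmx L M j w.
rewrite !detE [LHS]addrC -mulrBr mulrC; congr (_ * _).
rewrite opprD addrACA subrr add0r sub0r mulmxBr mulmxN.
rewrite [X in X - _]mxE [X in _ - X]mxE [X in _ + X - _]mxE opprK subrK.
by rewrite -mulmxA /w mulKmx // -row_mul mxE.
Qed.

End ReplaceCol.

(** * Least squares *)

Section LeastSquares.
Variable C : numClosedFieldType.

Lemma adjmxM m n p (A : 'M[C]_(m, n)) (B : 'M[C]_(n, p)) :
  (A *m B)^t* = B^t* *m A^t*.
Proof. by rewrite trmx_mul map_mxM. Qed.

Lemma l2normE n (v : 'cV[C]_n) : l2norm v = sqrtC ((v^t* *m v) 0 0).
Proof.
congr sqrtC; rewrite mxE; apply: eq_bigr => i _.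
by rewrite !mxE normCKC.
Qed.

Lemma sqnorm_ge0 n (v : 'cV[C]_n) : 0 <= (v^t* *m v) 0 0.
Proof. by rewrite mxE sumr_ge0 // => i _; rewrite !mxE -normCKC exprn_ge0. Qed.

Lemma sqnorm_eq0 n (v : 'cV[C]_n) : (v^t* *m v) 0 0 = 0 -> v = 0.
Proof.
rewrite mxE => /psumr_eq0P v0; apply/colP => i; rewrite [RHS]mxE; apply/eqP.
rewrite -normr_eq0 -sqrf_eq0 normCKC; have := v0 _ i isT; rewrite !mxE => -> //.
by move=> k _; rewrite !mxE -normCKC exprn_ge0.
Qed.

(** By Pythagoras, adding an orthogonal vector to u increases the norm, unless
    that vector is 0. *)
Lemma l2norm_orth_le n (u v : 'cV[C]_n) :
  u^t* *m v = 0 -> l2norm (u + v) <= l2norm u -> v = 0.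
Proof.
move=> uv0; have vu0 : v^t* *m u = 0.
  by rewrite -[u]trmxCK -adjmxM uv0 trmx0 map_mx0.
rewrite !l2normE ler_sqrtC ?nnegrE ?sqnorm_ge0 //.
have -> : (u + v)^t* = u^t* + v^t* by rewrite raddfD /= map_mxD.
rewrite mulmxDl !mulmxDr uv0 vu0 add0r addr0 mxE gerDl.
by move=> v_le0; apply/sqnorm_eq0/le_anti; rewrite v_le0 sqnorm_ge0.
Qed.

(** The residual A x1 - y is orthogonal to the range of A, and x1 = A^* w is
    orthogonal to the kernel of A. The first fact forces A x0 = A x1 for every
    minimizer x0, so that x1 is a minimizer too; then x0 - x1 lies in the
    kernel, and the second fact makes x0 longer than x1 unless they agree. *)
Lemma least_squares_solution_unique m n (A : 'M[C]_(m, n)) y x0 x1 w :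
  is_least_squares_solution A y x0 ->
  A^t* *m A *m x1 = A^t* *m y -> x1 = A^t* *m w -> x0 = x1.
Proof.
move=> [min_x0 short_x0] normal_x1 def_x1.
have residual_orth : (A *m x1 - y)^t* *m A = 0.
  rewrite -[LHS]trmxCK adjmxM trmxCK mulmxBr mulmxA normal_x1 subrr.
  by rewrite trmx0 map_mx0.
have A_orth : A *m (x0 - x1) = 0.
  apply: (@l2norm_orth_le _ (A *m x1 - y)).
    by rewrite mulmxA residual_orth mul0mx.
  by rewrite mulmxBr addrC addrA subrK; apply: min_x0.
have eq_Ax : A *m x0 = A *m x1 by apply/eqP; rewrite -subr_eq0 -mulmxBr A_orth.
apply/eqP; rewrite -subr_eq0; apply/eqP/(@l2norm_orth_le _ x1).
  by rewrite {1}def_x1 adjmxM trmxCK -mulmxA A_orth mulmx0.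
by rewrite addrC subrK; apply: short_x0 => z; rewrite -eq_Ax; apply: min_x0.
Qed.

Lemma row_free_adj m n (A : 'M[C]_(m, n)) : row_free (A^t*) = row_full A.
Proof. by rewrite row_free_map /row_free mxrank_tr. Qed.

(** If v A A^* = 0 then v A (v A)^* = 0, that is, v A has norm 0. *)
Lemma unitmx_gram m n (A : 'M[C]_(m, n)) :
  row_free A -> A *m A^t* \in unitmx.
Proof.
move=> freeA; rewrite -row_free_unit; apply: inj_row_free => v vAA0.
have vA0 : (v *m A)^t* = 0.
  apply: sqnorm_eq0; rewrite trmxCK adjmxM mulmxA -(mulmxA v) vAA0 mul0mx.
  by rewrite mxE.
apply/eqP; rewrite -(mulmx_free_eq0 _ freeA) -[v *m A]trmxCK vA0.
by rewrite trmx0 map_mx0.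
Qed.

(** MacDuffee's formula A^+ = Q^* (Q Q^* )^-1 (P^* P)^-1 P^* for the
    Moore-Penrose inverse of A = P Q, applied to y. *)
Lemma least_squares_full_rank m r n (P : 'M[C]_(m, r)) (Q : 'M[C]_(r, n)) y x0 :
  row_full P -> row_free Q -> is_least_squares_solution (P *m Q) y x0 ->
  let L := Q^t* in let M := P^t* *m P *m Q in
  M *m L \in unitmx /\ x0 = L *m (invmx (M *m L) *m (P^t* *m y)).
Proof.
move=> fullP freeQ lss L M.
have uP : P^t* *m P \in unitmx.
  by rewrite -{2}[P]trmxCK unitmx_gram // row_free_adj.
have uG : M *m L \in unitmx by rewrite -mulmxA unitmx_mul uP unitmx_gram.
split=> //; set u := invmx _ *m _.
apply: (least_squares_solution_unique (w := P *m (invmx (P^t* *m P) *m u)) lss).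
  rewrite adjmxM -!mulmxA; congr (_ *m _).
  by rewrite /u !mulmxA mulmxV ?mul1mx // -?mulmxA.
by rewrite adjmxM -mulmxA (mulmxA (P^t*)) mulmxA -(mulmxA L) mulKVmx.
Qed.

Lemma normal_equations m n (A : 'M[C]_(m, n)) y x0 :
  is_least_squares_solution A y x0 -> A^t* *m A *m x0 = A^t* *m y.
Proof.
move: (col_base_full A) (row_base_free A) (mulmx_base A).
move: (col_base A) (row_base A) => P Q fullP freeQ <- lss.
have [uG ->] := least_squares_full_rank fullP freeQ lss.
rewrite adjmxM -!mulmxA; congr (_ *m _).
by rewrite !mulmxA mulmxV ?mul1mx // -?mulmxA.
Qed.

End LeastSquares.

(** * Cramer's rule for the least squares solution *)

Theorem theorem4p2 (R : realType) (m n : nat)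
    (A : 'M[R[i]]_(m, n)) (y : 'cV[R[i]]_m) (x0 : 'cV[R[i]]_n)
    (hx0 : is_least_squares_solution A y x0) :
  let f : 'cV[R[i]]_n := A ^t* *m y in
  let B : 'M[R[i]]_n := A ^t* *m A in
  (\rank A = n ->
     forall j : 'I_n, x0 j 0 = \det (replace_col B j f) / \det B) /\
  (forall r : nat, (1 <= r)%N -> \rank A = r -> (r <= m)%N -> (m < n)%N ->
     forall j : 'I_n,
       x0 j 0 =
         (\sum_(beta in J_at r j) principal_minor (replace_col B j f) beta)
         / sum_principal_minors r B).
Proof.
move=> f B; split=> [rankA j | r _ rankA _ _ j].
  have uB : B \in unitmx.
    rewrite /B -{2}[A]trmxCK unitmx_gram // row_free_adj.
    by rewrite /row_full rankA.
  by rewrite /f -(normal_equations hx0) Cramer_rule mulrC mulKf.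
move: (col_base_full A) (row_base_free A) (mulmx_base A).
move: (col_base A) (row_base A); rewrite rankA => P Q fullP freeQ defA.
have lss := hx0; rewrite -defA in lss.
have [uG def_x0] := least_squares_full_rank fullP freeQ lss.
set L := Q^t* in uG def_x0; set M := P^t* *m P *m Q in uG def_x0.
have defB : B = L *m M by rewrite /B -defA adjmxM !mulmxA.
have deff : f = L *m (M *m L *m (invmx (M *m L) *m (P^t* *m y))).
  by rewrite mulKVmx // mulmxA -adjmxM defA.
rewrite defB deff sum_minors_replace_col // sum_principal_minors_mulmx -def_x0.
by rewrite mulfK // -unitfE -unitmxE.
Qed.
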